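(* Let $X$ be a nonempty set, $\Omega\subseteq\mathcal P(X)$ an algebra of sets, and $\mu$ a finite measure on $\Omega$ with induced outer measure $\mu^{*}$. Let $\overline{\Omega}$ be the set of equivalence classes of $\mu$-Cauchy sequences in $\Omega$, with metric $\bar d(\overline{\{A_n\}},\overline{\{B_n\}})=\lim_{n}\mu(A_n\triangle B_n)$. Let $\widetilde{\mathbf S}=\{S\subseteq X:\ \text{there is a }\mu\text{-Cauchy sequence }\{B_n\}\subseteq\Omega\text{ with }\lim_n\mu^{*}(B_n\triangle S)=0\}$, let $\sim$ be the equivalence relation on $\widetilde{\mathbf S}$ given by $A\sim B$ iff $\mu^{*}(A\triangle B)=0$, and equip $\widetilde{\mathbf S}/\!\sim$ with the metric $d([A],[B])=\mu^{*}(A\triangle B)$. Define $F:\overline{\Omega}\to\widetilde{\mathbf S}/\!\sim$ by $F(\overline{\{B_n\}})=[B]$, where $B\subseteq X$ is any set with $\lim_n\mu^{*}(B_n\triangle B)=0$. Then $F$ is an isometry from $\overline{\Omega}$ onto $\widetilde{\mathbf S}/\!\sim$, i.e. $F$ is a bijection and $\bar d(E,E')=d(F(E),F(E'))$ for all $E,E'\in\overline{\Omega}$.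
   Context: $\mu^{*}$ is the outer measure induced by $\mu$: $\mu^{*}(A)=\inf\{\sum_i\mu(A_i): A_i\in\Omega,\ A\subseteq\bigcup_iA_i\}$. A sequence $\{B_n\}$ in $\Omega$ is $\mu$-Cauchy if $\mu(B_n\triangle B_m)\to0$ as $n,m\to\infty$. Two $\mu$-Cauchy sequences $\{A_n\},\{B_n\}$ are equivalent iff $\lim_n\mu(A_n\triangle B_n)=0$; $\overline{\{B_n\}}$ denotes the class of $\{B_n\}$, so $(\overline{\Omega},\bar d)$ is the metric completion of the pseudometric space $(\Omega,d)$, $d(A,B)=\mu^{*}(A\triangle B)$. For every $\mu$-Cauchy sequence $\{B_n\}$ a set $B\subseteq X$ with $\lim_n\mu^{*}(B_n\triangle B)=0$ exists, and $[B]$ denotes the $\sim$-class of $B$. *)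

(* Defs.v *)
From HB Require Import structures.
From mathcomp Require Import all_boot all_order all_algebra generic_quotient.
From mathcomp Require Import all_classical reals ereal topology normedtype.
From mathcomp Require Import sequences measure metric_structure.
From mathcomp Require Import lra.
Set Implicit Arguments.
Unset Strict Implicit.
Unset Printing Implicit Defensive.
Import Order.TTheory GRing.Theory Num.Theory.
Import numFieldNormedType.Exports.
Local Open Scope classical_set_scope.
Local Open Scope ring_scope.
Local Open Scope ereal_scope.
Local Open Scope measure_scope.
Local Open Scope quotient_scope.

Section definitions.
Context {d : measure_display} {T : algebraOfSetsType d} {R : realType}.
Variable mu : {measure set T -> \bar R}.
Implicit Types (A B : (set T)^nat) (S : set T).

Definition mu_cauchy B : Prop := (forall n, measurable (B n)) /\
  (fun nm : nat * nat => mu (B nm.1 `+` B nm.2)) @ (\oo, \oo) --> 0.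

Definition mu_converges B S : Prop := mu^* (B n `+` S) @[n --> \oo] --> 0.

Definition cauchySeq : Type := [set B | mu_cauchy B].
HB.instance Definition _ := Choice.on cauchySeq.

Definition limitSet : Type :=
  [set S | exists2 B, mu_cauchy B & mu_converges B S].
HB.instance Definition _ := Choice.on limitSet.

Definition cauchy_equiv (A B : cauchySeq) : bool :=
  `[< mu (val A n `+` val B n) @[n --> \oo] --> 0 >].

Definition limit_equiv (A B : limitSet) : bool := mu^* (val A `+` val B) == 0.

End definitions.
Arguments mu_cauchy {d T R} mu B.
Arguments mu_converges {d T R} mu B S.

Section outer_distance.
Context {d : measure_display} {T : algebraOfSetsType d} {R : realType}.
Variable mu : {measure set T -> \bar R}.
Implicit Types (A B C S : set T).

Lemma measurableY A B : measurable A -> measurable B -> measurable (A `+` B).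
Proof. by move=> mA mB; apply: measurableU; exact: measurableD. Qed.

Lemma mu_ext_triangle B A C :
  mu^* (A `+` C) <= mu^* (A `+` B) + mu^* (B `+` C).
Proof.
apply: le_trans (outer_measureU2 _ _ _); apply: le_mu_ext => x.
by rewrite /setY /=; have := EM (B x); tauto.
Qed.

Lemma mu_extY A B : measurable A -> measurable B ->
  mu^* (A `+` B) = mu (A `+` B).
Proof. by move=> mA mB; rewrite measurable_mu_extE//; exact: measurableY. Qed.

Lemma cauchy_equivP (A B : cauchySeq mu) :
  cauchy_equiv A B <-> mu^* (val A n `+` val B n) @[n --> \oo] --> 0.
Proof.
have /set_mem[mA _] := valP A; have /set_mem[mB _] := valP B.
have -> : (fun n => mu^* (val A n `+` val B n)) =
          (fun n => mu (val A n `+` val B n)).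
  by apply/funext => n; rewrite mu_extY.
by split => [/asboolP|?]//; exact/asboolP.
Qed.

Lemma cvg0_mu_ext_triangle (A B C : (set T)^nat) :
  mu^* (A n `+` B n) @[n --> \oo] --> 0 ->
  mu^* (B n `+` C n) @[n --> \oo] --> 0 ->
  mu^* (A n `+` C n) @[n --> \oo] --> 0.
Proof.
move=> AB BC.
apply: (@squeeze_cvge _ _ _ _ (fun=> 0) _
  (fun n => mu^* (A n `+` B n) + mu^* (B n `+` C n))).
- by near=> n; rewrite mu_ext_ge0//= mu_ext_triangle.
- exact: cvg_cst.
- by rewrite -(adde0 0); exact: cvgeD.
Unshelve. all: by end_near. Qed.

Lemma cauchy_equiv_refl : reflexive (@cauchy_equiv d T R mu).
Proof.
move=> A; apply/cauchy_equivP.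
under eq_fun do rewrite setYK mu_ext0//.
exact: cvg_cst.
Qed.

Lemma cauchy_equiv_sym : symmetric (@cauchy_equiv d T R mu).
Proof.
suff sub (C D : cauchySeq mu) : cauchy_equiv C D -> cauchy_equiv D C.
  by move=> A B; apply/idP/idP; exact: sub.
move=> /cauchy_equivP CD; apply/cauchy_equivP.
by under eq_fun do rewrite setYC.
Qed.

Lemma cauchy_equiv_trans : transitive (@cauchy_equiv d T R mu).
Proof.
move=> B A C /cauchy_equivP AB /cauchy_equivP BC; apply/cauchy_equivP.
exact: cvg0_mu_ext_triangle AB BC.
Qed.

Lemma limit_equiv_refl : reflexive (@limit_equiv d T R mu).
Proof. by move=> A; rewrite /limit_equiv setYK mu_ext0. Qed.

Lemma limit_equiv_sym : symmetric (@limit_equiv d T R mu).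
Proof. by move=> A B; rewrite /limit_equiv setYC. Qed.

Lemma limit_equiv_trans : transitive (@limit_equiv d T R mu).
Proof.
move=> B A C /eqP AB /eqP BC; rewrite /limit_equiv eq_le mu_ext_ge0// andbT.
by rewrite (le_trans (mu_ext_triangle (val B) _ _))// AB BC adde0.
Qed.

Canonical cauchy_equiv_rel := EquivRel (@cauchy_equiv d T R mu)
  cauchy_equiv_refl cauchy_equiv_sym cauchy_equiv_trans.

Canonical limit_equiv_rel := EquivRel (@limit_equiv d T R mu)
  limit_equiv_refl limit_equiv_sym limit_equiv_trans.

(* The finiteness hypothesis is an argument of the quotient types because it
   is what makes the distances below real-valued. *)
Definition cauchyQuot of fin_num_fun mu : Type := {eq_quot cauchy_equiv_rel}.
Definition limitQuot of fin_num_fun mu : Type := {eq_quot limit_equiv_rel}.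

End outer_distance.

Section quotients.
Context {d : measure_display} {T : algebraOfSetsType d} {R : realType}.
Context {mu : {measure set T -> \bar R}} (mufin : fin_num_fun mu).
Implicit Types (A B C S : set T).

HB.instance Definition _ := EqQuotient.on (cauchyQuot mufin).
HB.instance Definition _ := Choice.on (cauchyQuot mufin).
HB.instance Definition _ := EqQuotient.on (limitQuot mufin).
HB.instance Definition _ := Choice.on (limitQuot mufin).

Lemma mu_ext_fin A : mu^* A \is a fin_num.
Proof.
rewrite ge0_fin_numE ?mu_ext_ge0//.
apply: (@le_lt_trans _ _ (mu^* [set: T])); first exact: le_mu_ext.
rewrite measurable_mu_extE; last exact: measurableT.
by rewrite ltey_eq mufin//; exact: measurableT.
Qed.

Definition limit_dist (E E' : limitQuot mufin) : R :=
  fine (mu^* (val (repr E) `+` val (repr E'))).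

Definition cauchy_dist (E E' : cauchyQuot mufin) : R :=
  fine (limn (fun n => mu (val (repr E) n `+` val (repr E') n))).

Let dm A B : R := fine (mu^* (A `+` B)).

Let dmE A B : mu^* (A `+` B) = (dm A B)%:E.
Proof. by rewrite fineK// mu_ext_fin. Qed.

Let dm_ge0 A B : (0 <= dm A B)%R.
Proof. by rewrite -lee_fin -dmE mu_ext_ge0. Qed.

Let dmC A B : dm A B = dm B A.
Proof. by rewrite /dm setYC. Qed.

Let dm_triangle B A C : (dm A C <= dm A B + dm B C)%R.
Proof. by rewrite -lee_fin EFinD -!dmE mu_ext_triangle. Qed.

Let cvg0P (u : R^nat) : (u n)%:E @[n --> \oo] --> 0 <->
  forall e : R, (0 < e)%R -> exists N, forall n, (N <= n)%N -> (`|u n| < e)%R.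
Proof.
split.
  move=> /fine_cvgP[_ /cvgr0Pnorm_lt u0] e e0.
  by have [N _ NP] := u0 e e0; exists N => n Nn; exact: NP.
move=> uP; apply: cvg_EFin => /=; first by near=> n.
apply/cvgr0Pnorm_lt => e e0; have [N NP] := uP e e0.
by exists N => // n; exact: NP.
Unshelve. all: by end_near. Qed.

Lemma mu_cauchyP (B : (set T)^nat) : mu_cauchy mu B -> forall e : R, (0 < e)%R ->
  exists N, forall n m, (N <= n)%N -> (N <= m)%N ->
    (fine (mu_ext mu (B n `+` B m)) < e)%R.
Proof.
move=> [mB /fine_cvgP[_ /cvgr0Pnorm_lt cB]] e e0.
have [[P Q] [/= [N1 _ N1P] [N2 _ N2Q]] PQ] := cB e e0.
exists (maxn N1 N2) => n m; rewrite !geq_max => /andP[N1n _] /andP[_ N2m].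
have /= := PQ (n, m) (conj (N1P _ N1n) (N2Q _ N2m)).
by rewrite mu_extY//; apply: le_lt_trans; exact: ler_norm.
Qed.

Lemma mu_cauchy_converges (B : (set T)^nat) : mu_cauchy mu B ->
  exists S, mu_converges mu B S.
Proof.
move=> cB; have [mB _] := cB.
have e_gt0 k : (0 < 2^-1 ^+ k :> R)%R by rewrite exprn_gt0// invr_gt0.
have /choice[N NP] k := mu_cauchyP cB (e_gt0 k).
pose C k := B (N k).
pose S := \bigcap_m \bigcup_(k in [set k | (m <= k)%N]) C k.
have CC k : (dm (C k) (C k.+1) <= 2 * 2^-1 ^+ k)%R.
  pose p := maxn (N k) (N k.+1).
  have h1 : (dm (C k) (B p) < 2^-1 ^+ k)%R by apply: NP => //; exact: leq_maxl.
  have h2 : (dm (B p) (C k.+1) < 2^-1 ^+ k.+1)%R.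
    by apply: NP => //; exact: leq_maxr.
  have := dm_triangle (B p) (C k) (C k.+1).
  by have := e_gt0 k; move: h2; rewrite exprS; lra.
have CS m : (dm (C m) S <= 4 * 2^-1 ^+ m)%R.
  have sub : C m `+` S `<=` \bigcup_k (C (m + k)%N `+` C (m + k).+1).
    move=> x; apply: contraPP => nx.
    have step k : C (m + k)%N x <-> C m x.
      elim: k => [|k IH]; first by rewrite addn0.
      rewrite -IH addnS; apply: contrapT => h; apply: nx; exists k => //.
      rewrite /setY/=.
      by have := EM (C (m + k)%N x); have := EM (C (m + k).+1 x); tauto.
    have SC : S x <-> C m x.
      split=> [/(_ m I)[k /= mk]|Cx n _].
        by rewrite -(subnKC mk) step.
      by exists (m + n)%N; [exact: leq_addl|exact/step].
    by rewrite /setY/=; tauto.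
  rewrite -lee_fin -dmE (le_trans (le_mu_ext mu sub))//.
  rewrite (le_trans (outer_measure_sigma_subadditive mu^* _))//.
  have e0 : (0 <= 4 * 2^-1 ^+ m :> R)%R by rewrite mulr_ge0// ltW.
  apply: le_trans (epsilon_trick0 xpredT e0); apply: lee_nneseries => /=.
    by move=> k _ _; exact: outer_measure_ge0.
  move=> k _; rewrite dmE lee_fin (le_trans (CC _))//.
  rewrite exprD natrX -exprVn exprS.
  by have := e_gt0 m; have := e_gt0 k; nra.
exists S; rewrite /mu_converges; under eq_fun do rewrite dmE.
apply/cvg0P => e e0.
have [m me] : exists m, (5 * 2^-1 ^+ m < e)%R.
  have /cvgr0Pnorm_lt/(_ e e0)[m _ /(_ m (leqnn m))/=] :
      (fun m => 5 * 2^-1 ^+ m : R)%R @ \oo --> (0 : R)%R.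
    by apply: cvg_geometric; rewrite ger0_norm ?invr_ge0// invf_lt1// ltr1n.
  by move=> /(le_lt_trans (ler_norm _)) ?; exists m.
exists (N m) => n Nn; rewrite ger0_norm//.
have h : (dm (B n) (C m) < 2^-1 ^+ m)%R by exact: NP.
by have := dm_triangle (C m) (B n) S; have := CS m; lra.
Qed.

Let dm_abs A B C D : (`|dm A B - dm C D| <= dm A C + dm B D)%R.
Proof.
rewrite ler_norml; have := dm_triangle C A B; have := dm_triangle D C B.
have := dm_triangle A C D; have := dm_triangle B A D.
by rewrite (dmC D B) (dmC C A); lra.
Qed.

Let is_cvg_dm (A B : cauchySeq mu) : cvg (dm (val A n) (val B n) @[n --> \oo]).
Proof.
apply: cauchy_cvg; apply/cauchy_exP => e e0.
have e2 : (0 < e / 2)%R by rewrite divr_gt0.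
have [N NP] := mu_cauchyP (set_mem (valP A)) e2.
have [M MP] := mu_cauchyP (set_mem (valP B)) e2.
pose p := maxn N M; exists (dm (val A p) (val B p)).
exists p => // n /= pn; rewrite /ball/= (le_lt_trans (dm_abs _ _ _ _))//.
have h1 : (dm (val A p) (val A n) < e / 2)%R.
  by apply: NP; [exact: leq_maxl|exact: leq_trans (leq_maxl _ _) pn].
have h2 : (dm (val B p) (val B n) < e / 2)%R.
  by apply: MP; [exact: leq_maxr|exact: leq_trans (leq_maxr _ _) pn].
by lra.
Qed.

Let mu_dm (A B : cauchySeq mu) :
  (fun n => mu (val A n `+` val B n)) = (fun n => (dm (val A n) (val B n))%:E).
Proof.
have /set_mem[mA _] := valP A; have /set_mem[mB _] := valP B.
by apply/funext => n; rewrite -dmE mu_extY.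
Qed.

Let cauchy_distE (E E' : cauchyQuot mufin) :
  cauchy_dist E E' = limn (fun n => dm (val (repr E) n) (val (repr E') n)).
Proof. by rewrite /cauchy_dist mu_dm EFin_lim. Qed.

Let cauchy_distP (A B : cauchySeq mu) :
  mu (val A n `+` val B n) @[n --> \oo] -->
    (cauchy_dist (\pi_(cauchyQuot mufin) A) (\pi_(cauchyQuot mufin) B))%:E.
Proof.
set E := \pi A; set E' := \pi B.
have dm0 (C : cauchySeq mu) :
    dm (val (repr (\pi_(cauchyQuot mufin) C)) n) (val C n) @[n --> \oo] --> 0%R.
  have : cauchy_equiv (repr (\pi_(cauchyQuot mufin) C)) C.
    by apply/(@eqmodP _ (cauchy_equiv_rel mu)); rewrite reprK.
  move=> /asboolP; rewrite mu_dm; exact: fine_cvg.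
rewrite mu_dm cauchy_distE; apply: cvg_EFin; first by near=> n.
have EE' := @is_cvg_dm (repr E) (repr E').
apply/cvgrPdist_lt => /= e e0.
have e3 : (0 < e / 3)%R by rewrite divr_gt0.
near=> n.
have h1 : (`|0 - dm (val (repr E) n) (val A n)| < e / 3)%R.
  by near: n; move/cvgrPdist_lt: (dm0 A); apply.
have h2 : (`|0 - dm (val (repr E') n) (val B n)| < e / 3)%R.
  by near: n; move/cvgrPdist_lt: (dm0 B); apply.
have h3 : (`|limn (fun n => dm (val (repr E) n) (val (repr E') n)) -
    dm (val (repr E) n) (val (repr E') n)| < e / 3)%R.
  by near: n; move/cvgrPdist_lt: EE'; apply.
have h4 := dm_abs (val (repr E) n) (val (repr E') n) (val A n) (val B n).
rewrite (le_lt_trans (ler_distD (dm (val (repr E) n) (val (repr E') n)) _ _))//.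
move: h1; rewrite sub0r normrN (ger0_norm (dm_ge0 _ _)) => h1.
move: h2; rewrite sub0r normrN (ger0_norm (dm_ge0 _ _)) => h2.
have : (dm (val (repr E) n) (val A n) + dm (val (repr E') n) (val B n) <
        e / 3 + e / 3)%R by exact: ltrD.
by move=> /(le_lt_trans h4) h5; have := ltrD h3 h5; lra.
Unshelve. all: by end_near. Qed.

Let limit_distE (A B : limitSet mu) :
  limit_dist (\pi_(limitQuot mufin) A) (\pi_(limitQuot mufin) B) =
  fine (mu^* (val A `+` val B)).
Proof.
have dm0 (C : limitSet mu) :
    dm (val (repr (\pi_(limitQuot mufin) C))) (val C) = 0%R.
  have /eqP : limit_equiv (repr (\pi_(limitQuot mufin) C)) C.
    by apply/(@eqmodP _ (limit_equiv_rel mu)); rewrite reprK.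
  by rewrite /dm => ->.
apply/eqP; rewrite -subr_eq0 -normr_le0 (le_trans (dm_abs _ _ _ _))//.
by rewrite !dm0 addr0.
Qed.

Let cauchy_distxx E : cauchy_dist E E = 0%R.
Proof.
rewrite cauchy_distE (_ : (fun _ => _) = cst 0%R) ?lim_cst//.
by apply/funext => n; rewrite /dm setYK mu_ext0.
Qed.

Let cauchy_dist_eq0 E E' : cauchy_dist E E' = 0%R -> E = E'.
Proof.
rewrite -[E]reprK -[E']reprK => h; apply/(@eqmodP _ (cauchy_equiv_rel mu)).
by apply/asboolP; have := @cauchy_distP (repr E) (repr E'); rewrite h.
Qed.

Let cauchy_distC E E' : cauchy_dist E E' = cauchy_dist E' E.
Proof. by rewrite !cauchy_distE; under eq_fun do rewrite dmC. Qed.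

Let cauchy_dist_triangle E' E E'' :
  (cauchy_dist E E'' <= cauchy_dist E E' + cauchy_dist E' E'')%R.
Proof.
rewrite !cauchy_distE -limD//.
apply: ler_lim; [exact: is_cvg_dm|by apply: is_cvgD; exact: is_cvg_dm|].
by near=> n; exact: dm_triangle.
Unshelve. all: by end_near. Qed.

HB.instance Definition _ := isMetric.Build R (cauchyQuot mufin)
  cauchy_distxx cauchy_dist_eq0 cauchy_distC cauchy_dist_triangle.

Let limit_distxx E : limit_dist E E = 0%R.
Proof. by rewrite /limit_dist setYK mu_ext0. Qed.

Let limit_dist_eq0 E E' : limit_dist E E' = 0%R -> E = E'.
Proof.
rewrite -[E]reprK -[E']reprK limit_distE => h.
by apply/(@eqmodP _ (limit_equiv_rel mu)); rewrite /= /limit_equiv dmE /dm h.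
Qed.

Let limit_distC E E' : limit_dist E E' = limit_dist E' E.
Proof. exact: dmC. Qed.

Let limit_dist_triangle E' E E'' :
  (limit_dist E E'' <= limit_dist E E' + limit_dist E' E'')%R.
Proof. exact: dm_triangle. Qed.

HB.instance Definition _ := isMetric.Build R (limitQuot mufin)
  limit_distxx limit_dist_eq0 limit_distC limit_dist_triangle.

Lemma cauchy_mdistP (A B : cauchySeq mu) :
  mu (val A n `+` val B n) @[n --> \oo] -->
    (mdist (\pi_(cauchyQuot mufin) A) (\pi_(cauchyQuot mufin) B))%:E.
Proof. exact: cauchy_distP. Qed.

Lemma limit_mdistE (A B : limitSet mu) :
  (mdist (\pi_(limitQuot mufin) A) (\pi_(limitQuot mufin) B))%:E =
  mu^* (val A `+` val B).
Proof. by rewrite /mdist /= limit_distE -/(dm _ _) dmE. Qed.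

Lemma cauchySeq_limit (B : cauchySeq mu) :
  exists S : limitSet mu, mu_converges mu (val B) (val S).
Proof.
have cB := set_mem (valP B); have [S BS] := mu_cauchy_converges cB.
have SS : S \in [set S | exists2 B, mu_cauchy mu B & mu_converges mu B S].
  by rewrite inE; exists (val B).
by exists (Sub S SS); rewrite SubK.
Qed.

(* The value does not depend on the representative [repr E] nor on the limit
   set picked by [cid]: see [limit_classE]. *)
Definition limit_class (E : cauchyQuot mufin) : limitQuot mufin :=
  \pi_(limitQuot mufin) (sval (cid (cauchySeq_limit (repr E)))).

Lemma limit_classE (B : cauchySeq mu) (S : limitSet mu) :
  mu_converges mu (val B) (val S) ->
  limit_class (\pi_(cauchyQuot mufin) B) = \pi_(limitQuot mufin) S.
Proof.
rewrite /limit_class; case: cid => S' /= BS' BS.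
apply/(@eqmodP _ (limit_equiv_rel mu)) => /=.
have BB : cauchy_equiv (repr (\pi_(cauchyQuot mufin) B)) B.
  by apply/(@eqmodP _ (cauchy_equiv_rel mu)); rewrite reprK.
have h : mu^* (val S' `+` val S) @[n --> \oo] --> 0.
  apply: (@cvg0_mu_ext_triangle _ _ _ _ _ (val B)) BS.
  apply: cvg0_mu_ext_triangle; last exact/cauchy_equivP/BB.
  by under eq_fun do rewrite setYC.
by apply/eqP; rewrite -(cvg_lim _ h)// lim_cst.
Qed.

End quotients.
Arguments limit_class {d T R mu} mufin E.
Arguments cauchy_mdistP {d T R mu} mufin A B.
Arguments limit_mdistE {d T R mu} mufin A B.

(* Main.v *)
(* The pseudometric mu^*(A `+` B) is continuous along A_n -> S and B_n -> S', so
   the limit of mu(A_n `+` B_n) is mu^*(S `+` S'): this is the isometry, which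
   yields injectivity. Surjectivity holds because every set in [limitSet] is a
   limit of a Cauchy sequence. *)
Require Import Defs.
From mathcomp Require Import all_boot all_order all_algebra.
From mathcomp Require Import all_classical reals ereal topology normedtype.
From mathcomp Require Import sequences measure metric_structure.
From mathcomp Require Import generic_quotient.
Import Order.TTheory GRing.Theory.
Local Open Scope ring_scope.
Local Open Scope classical_set_scope.
Local Open Scope ereal_scope.
Local Open Scope measure_scope.
Local Open Scope quotient_scope.

Lemma lee_cvg {R : realFieldType} (u v : (\bar R)^nat) (a b : \bar R) :
  u @ \oo --> a -> v @ \oo --> b -> (forall n, u n <= v n) -> a <= b.
Proof.
move=> ua vb uv; rewrite -(cvg_lim (@ereal_hausdorff R) ua).
rewrite -(cvg_lim (@ereal_hausdorff R) vb).
apply: lee_lim; [by apply: cvgP ua|by apply: cvgP vb|exact: nearW].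
Qed.

(** The triangle inequality along [A n], [S], [S'], [B n] and along [S], [A n], [B n], [S'] bounds
    each distance by the other plus errors that vanish in the limit; the two limits give both
    inequalities. *)
Lemma mu_ext_setY_cvg {d : measure_display} {T : algebraOfSetsType d}
    {R : realType} {mu : {measure set T -> \bar R}} {A B : (set T)^nat}
    {S S' : set T} {l : \bar R} :
  mu_converges mu A S -> mu_converges mu B S' ->
  mu^* (A n `+` B n) @[n --> \oo] --> l -> l = mu^* (S `+` S').
Proof.
move=> AS BS' ABl.
have AB_ub n : mu^* (A n `+` B n) <=
    mu^* (A n `+` S) + (mu^* (S `+` S') + mu^* (B n `+` S')).
  rewrite (setYC (B n)) (le_trans (mu_ext_triangle mu S _ _))// leeD2l//.
  exact: mu_ext_triangle.
have SS'_ub n : mu^* (S `+` S') <=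
    mu^* (A n `+` S) + (mu^* (A n `+` B n) + mu^* (B n `+` S')).
  rewrite (setYC (A n) S) (le_trans (mu_ext_triangle mu (A n) _ _))// leeD2l//.
  exact: mu_ext_triangle.
(* Both error terms tend to the finite value 0, so the sum of the limits is defined even if [x] is
   infinite. *)
have sum_cvg (u : (\bar R)^nat) (x : \bar R) : u @ \oo --> x ->
    mu^* (A n `+` S) + (u n + mu^* (B n `+` S')) @[n --> \oo] --> x.
  move=> ux; have -> : x = 0 + (x + 0) by rewrite adde0 add0e.
  apply: cvgeD => //.
  by apply: cvgeD => //; rewrite fin_num_adde_defl.
apply/eqP; rewrite eq_le; apply/andP; split.
  exact: lee_cvg ABl (sum_cvg _ _ (cvg_cst (mu^* (S `+` S')))) AB_ub.
exact: lee_cvg (cvg_cst _) (sum_cvg _ _ ABl) SS'_ub.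
Qed.

Lemma limit_class_isometry {d : measure_display} {T : algebraOfSetsType d}
    {R : realType} {mu : {measure set T -> \bar R}} (mufin : fin_num_fun mu)
    (E E' : cauchyQuot mufin) :
  mdist E E' = mdist (limit_class mufin E) (limit_class mufin E').
Proof.
rewrite -[E]reprK -[E']reprK.
(* By [limit_classE], any limit sets of the representatives compute the two images. *)
have [S ES] := cauchySeq_limit mufin (repr E).
have [S' ES'] := cauchySeq_limit mufin (repr E').
rewrite (limit_classE mufin ES) (limit_classE mufin ES').
apply: EFin_inj; rewrite limit_mdistE.
apply: (mu_ext_setY_cvg ES ES').
have /set_mem[mE _] := valP (repr E); have /set_mem[mE' _] := valP (repr E').
(* On the algebra [mu^*] agrees with [mu], which turns the goal into the limit that defines the
   distance of Cauchy classes. *)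
under eq_fun do rewrite mu_extY//.
exact: cauchy_mdistP.
Qed.

Lemma limit_class_inj {d : measure_display} {T : algebraOfSetsType d}
    {R : realType} {mu : {measure set T -> \bar R}} (mufin : fin_num_fun mu) :
  injective (limit_class mufin).
Proof.
(* Classes with the same image are at distance 0, hence equal in the metric space
   [cauchyQuot mufin]. *)
move=> E E' FE; apply: mdist_positivity.
by rewrite limit_class_isometry FE mdistxx.
Qed.

Lemma limit_class_surj {d : measure_display} {T : algebraOfSetsType d}
    {R : realType} {mu : {measure set T -> \bar R}} (mufin : fin_num_fun mu)
    (D : limitQuot mufin) :
  exists E, limit_class mufin E = D.
Proof.
have /set_mem[B cB BS] := valP (repr D).
have [C CB] : exists C : cauchySeq mu, val C = B.
  by exists (Sub B (mem_set cB)); rewrite SubK.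
(* The preimage is the class of a Cauchy sequence converging to the representative of [D]. *)
exists (\pi C); rewrite -[D]reprK.
by apply: limit_classE; rewrite CB.
Qed.

Theorem theorem3 (d : measure_display) (T : algebraOfSetsType d) (R : realType)
    (mu : {measure set T -> \bar R}) (mufin : fin_num_fun mu) :
  bijective (limit_class mufin) /\
  forall E E' : cauchyQuot mufin,
    mdist E E' = mdist (limit_class mufin E) (limit_class mufin E').
Proof.
split; last exact: limit_class_isometry.
(* Choice turns surjectivity into a right inverse [G]; injectivity makes it a left inverse too. *)
have [G FG] := choice (limit_class_surj mufin).
by exists G => // E; apply: limit_class_inj; rewrite FG.
Qed.
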